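(* Let $N=\langle P,T,F,I\rangle$ be a Petri net with inhibitor arcs with initial marking $m_0$, and let $G_1,G_2\in\mathrm{comp}_g(N)$ be two different g-computations of $N$. Then there exists a set of nodes (p-histories) $v_1,\dots,v_n$ appearing in both $G_1$ and $G_2$ such that one of the following holds: 1. There is a node $v_i$ such that the number of tokens not taken from $v_i$ in $G_1$ and in $G_2$ is different. 2. The set of p-histories $v_1,\dots,v_n$ participates in some transition $t$ in $G_i$ but not in $G_{3-i}$, for some $i\in\{1,2\}$; that is, there is a t-history $e=(S,t)$ with $S$ a multiset whose underlying set is $\{v_1,\dots,v_n\}$ such that $e$ is an edge of $G_i$ and not an edge of $G_{3-i}$ (this includes the case where $t$ is taken from $v_1,\dots,v_n$ in both, but with different numbers of tokens taken from the nodes).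
   Context: **Labelled partial orders.** An LPO (with empty interleaving relation) is a tuple $(O,\rightarrow_c,\Sigma,\Upsilon,L)$ where $O=V\uplus E$ (nodes $V$, edges $E$); $\rightarrow_c\subseteq (V\times E)\cup(E\times V)$ is an irreflexive, antisymmetric relation (not required to be transitive); the reflexive transitive closure $\leq$ of $\rightarrow_c$ is a partial order; $L:O\to\Sigma\cup\Upsilon$ with $L(V)\subseteq\Sigma$, $L(E)\subseteq\Upsilon$. Write ${}^\bullet a=\{b\mid b\rightarrow_c a\}$, $a^\bullet=\{b\mid a\rightarrow_c b\}$. A glue relation over $O$ and $\rightarrow_c$ is a subset of $\rightarrow_c$. A g-LPO is $(P_g,\mathcal G,\mathcal E)$ with $P_g$ an LPO, $\mathcal G$ a set of glue relations, and $\mathcal E$ a map assigning glue relations in $\mathcal G$ to edge labels. **PTI-nets.** $N=\langle P,T,F,I\rangle$ with disjoint sets of places $P$ (finite) and transitions $T$, $F:(P\times T)\cup(T\times P)\to\mathbb N$, $I\subseteq P\times T$ (inhibitor arcs), and initial marking $m_0:P\to\mathbb N$. All transitions have a non-empty preset (for each $t$ some $F(p,t)>0$). For $t\in T$: ${}^\bullet t(p)=F(p,t)$, $t^\bullet(p)=F(t,p)$. A dummy transition $t_\epsilon\notin T$ has $t_\epsilon^\bullet=m_0$. **Histories** (defined by simultaneous induction). $(\emptyset,t_\epsilon)$ is a t-history. If $h=(S,t)$ is a t-history and $t^\bullet(p)>0$, then $(h,p,t^\bullet(p))$ is a p-history. For $t\in T$, $(S,t)$ is a t-history if $S=\{(h_1,i_1),\dots,(h_n,i_n)\}$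 is a multiset of p-histories ($h_j$ occurring $i_j$ times), where $h_j=(-,p_j,c_j)$, $c_j\geq i_j$, and ${}^\bullet t=\sum_j i_j\cdot\vec{p_j}$ ($\vec p$ is the unit vector of $p$). For a t-history $h=(S,t)$ and p-history $h'$, $h(h')$ is the multiplicity of $h'$ in $S$. $\mathrm{hist}_p(N),\mathrm{hist}_t(N)$ denote the sets of p-histories and t-histories. **g-computation of $N$.** $\mathrm{comp}_g(N)$ is the set of g-LPOs $(P_g,\mathcal G,\mathcal E)$ with $P_g=(O,\rightarrow_c,\Sigma,\Upsilon,L)$, $V\subseteq\mathrm{hist}_p(N)$, $E\subseteq\mathrm{hist}_t(N)$, $\Sigma=P$, $\Upsilon=T$ (plus the label $t_\epsilon$ of the dummy edge), $L((-,p,i))=p$, $L((S,t))=t$, such that: - N1. $(\emptyset,t_\epsilon)$ is the unique minimal element for $\leq$. - N2. For each $v=(e,p,i)\in V$: $e\in E$ and $e$ is the unique edge with $e\rightarrow_c v$. - N3. For each $v=(h,p,i)\in V$, if $e_1,e_2,\dots$ are the t-histories with $v\rightarrow_c e_j$, then $e_j(v)>0$ for every $j$ and $\sum_j e_j(v)\leq i$. - N4. For each $e=(\{(v_1,i_1),\dots,(v_n,i_n)\},t)\in E$: ${}^\bullet e=\{v_1,\dots,v_n\}$ and $e^\bullet=\{(e,p,t^\bullet(p))\mid t^\bullet(p)>0\}$. - N5. For every $t\in T$: $\mathcal E(t)=\{(v,e)\mid v\rightarrow_c e,\ (L(v),t)\in I\}\cup\{(e,v)\mid e\rightarrow_c v,\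 (L(v),t)\in I\}$. Here $\mathcal G$ is the set of values of $\mathcal E$, and the label $t_\epsilon$ has empty glue. **Tokens not taken.** For a node $v=(h,p,i)$ of a g-computation $G$, the number of tokens not taken from $v$ in $G$ is $i-\sum_{e:\,v\rightarrow_c e} e(v)$, the sum over edges $e$ of $G$. *)

(* Defs.v *)
From HB Require Import structures.
From Stdlib Require Import Relation_Definitions Relation_Operators.
From mathcomp Require Import all_boot.
From mathcomp Require Import finmap multiset.
From mathcomp Require Import boolp classical_sets functions cardinality fsbigop.

Set Implicit Arguments.
Unset Strict Implicit.
Unset Printing Implicit Defensive.

Local Open Scope nat_scope.
Local Open Scope mset_scope.
Local Open Scope classical_set_scope.

(** Labelled partial orders (with empty interleaving relation) and g-LPOs.
    Nodes are drawn from [nV] and edges from [nE], so that V and E are disjoint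
    inside [nV + nE]; [Sig] and [Ups] are the types of node and edge labels. The
    labelling is defined on V and E only, and glue relations are sets of pairs
    included in the arcs, so equality of g-LPOs is equality of the tuples. *)

Record gLPO (nV nE Sig Ups : Type) := GLPO {
  nodes : set nV;
  edges : set nE;
  arcs : set ((nV + nE) * (nV + nE))%type;
  nlab : nodes -> Sig;
  elab : edges -> Ups;
  glues : set (set ((nV + nE) * (nV + nE))%type);
  glue_of : Ups -> set ((nV + nE) * (nV + nE))%type }.

Section GLPO.
Variables nV nE Sig Ups : Type.
Local Notation O := (nV + nE)%type.
Implicit Type G : gLPO nV nE Sig Ups.

Definition objects G : set O := [set inl v | v in nodes G] `|` [set inr e | e in edges G].

Definition arc G (a b : O) : Prop := arcs G (a, b).

Definition lpo_le G : relation O := clos_refl_trans _ (arc G).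

Definition preset G (a : O) : set O := [set b | arc G b a].

Definition postset G (a : O) : set O := [set b | arc G a b].

Definition is_LPO G : Prop :=
  [/\ arcs G `<=` ([set inl v | v in nodes G] `*` [set inr e | e in edges G])
                  `|` ([set inr e | e in edges G] `*` [set inl v | v in nodes G]),
      forall a, ~ arc G a a,
      forall a b, arc G a b -> arc G b a -> a = b
    & Relation_Definitions.order O (lpo_le G)].

Definition is_glue_relation G (g : set (O * O)) : Prop :=
  g `<=` arcs G.

Definition is_gLPO G : Prop :=
  [/\ is_LPO G,
      forall g, glues G g -> is_glue_relation G g
    & forall u, glues G (glue_of G u)].

Definition is_minimal G (a : O) : Prop :=
  objects G a /\ forall b, objects G b -> lpo_le G b a -> b = a.

End GLPO.

(** Petri nets with inhibitor arcs, with their initial marking. *)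

Record ptiNet (P : finType) (T : Type) := PTINet {
  flow_in : P -> T -> nat;
  flow_out : T -> P -> nat;
  inhibitor : set (P * T);
  m0 : P -> nat;
  flow_in_neq0 : forall t, exists p, 0 < flow_in p t }.

(** Histories. A t-history is a pair (S, t) with S a finite multiset of triples
    (t-history, place, number) and [t : option T], where [None] is the dummy
    transition. Since multisets are not strictly positive, t-histories are
    obtained from finitely branching trees by choosing a canonical enumeration
    of the children at each vertex. The lemmas [mkthistE] and [thist_ind] below
    show that [mkthist] is a bijection onto [thist] and that [thist] is
    inductively generated by it; nothing else depends on the encoding. *)

Inductive htree (P T : Type) := HTree of seq (htree P T * P * nat) & option T.

HB.instance Definition _ P T := gen_eqMixin (htree P T).
HB.instance Definition _ P T := gen_choiceMixin (htree P T).

Definition canon_seq (K : choiceType) (s : seq K) : seq K := choose (perm_eq s) s.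

Lemma perm_canon_seq (K : choiceType) (s : seq K) : perm_eq s (canon_seq s).
Proof. by apply: chooseP. Qed.

Lemma canon_seqP (K : choiceType) (s s' : seq K) :
  perm_eq s s' -> canon_seq s = canon_seq s'.
Proof.
move=> ss'; rewrite /canon_seq.
have E : perm_eq s =1 perm_eq s' by move=> u; apply: (permPl ss').
by rewrite (eq_choose E); apply: choose_id; rewrite -?E.
Qed.

Section Histories.
Variables (P : finType) (T : Type).

Fixpoint canonical (r : htree P T) : bool :=
  let: HTree s _ := r in
  (canon_seq s == s) && all (fun x => let: (r', _, _) := x in canonical r') s.

Record thist := THist { htree_of : htree P T; htree_ofP : canonical htree_of }.

HB.instance Definition _ := [isSub for htree_of].
HB.instance Definition _ := [Choice of thist by <:].

(** Triples (h, p, c); the p-histories of a net are singled out below. *)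
Definition phist : choiceType := (thist * P * nat)%type.

Definition ph_src (v : phist) : thist := v.1.1.
Definition ph_place (v : phist) : P := v.1.2.
Definition ph_count (v : phist) : nat := v.2.

Let lower (v : phist) : htree P T * P * nat := (htree_of v.1.1, v.1.2, v.2).
Let raise (x : htree P T * P * nat) : option phist :=
  if insub x.1.1 is Some h then Some (h, x.1.2, x.2) else None.

Let lowerK : pcancel lower raise.
Proof. by move=> [[h p] c]; rewrite /raise /lower /= valK. Qed.

Let mkthist_canonical (S : {mset phist}) (t : option T) :
  canonical (HTree (canon_seq (map lower S)) t).
Proof.
rewrite /= -(canon_seqP (perm_canon_seq _)) eqxx /=.
rewrite -(perm_all _ (perm_canon_seq _)); apply/allP => _ /mapP[v _ ->].
exact: htree_ofP.
Qed.

(** The t-history (S, t). *)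
Definition mkthist (S : {mset phist}) (t : option T) : thist :=
  THist (mkthist_canonical S t).

Definition thist_mset (h : thist) : {mset phist} :=
  let: HTree s _ := htree_of h in seq_mset (pmap raise s).

Definition thist_lab (h : thist) : option T :=
  let: HTree _ t := htree_of h in t.

Lemma mkthistK_mset S t : thist_mset (mkthist S t) = S.
Proof.
rewrite /thist_mset /= -[RHS]seq_mset_id; apply/eq_seq_msetP.
rewrite -[X in perm_eq _ X](map_pK lowerK) perm_sym.
exact/perm_pmap/perm_canon_seq.
Qed.

Lemma mkthistK_lab S t : thist_lab (mkthist S t) = t.
Proof. by []. Qed.

Lemma mkthistE h : mkthist (thist_mset h) (thist_lab h) = h.
Proof.
apply: val_inj; case: h => -[s t] /= Hc.
rewrite /thist_mset /=; congr HTree; move/andP: (Hc) => [/eqP Hs /allP cs].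
rewrite -[RHS]Hs.
apply: canon_seqP; apply: (perm_trans (perm_map _ (perm_eq_seq_mset _))).
suff -> : map lower (pmap raise s) = s by [].
elim: s cs {Hc Hs} => //= -[[r p] c] s IH cs.
have cr : canonical r by exact: (cs (r, p, c) (mem_head _ _)).
have -> : raise (r, p, c) = Some (THist cr, p, c) by rewrite /raise /= insubT.
rewrite /= IH // => x xs; apply: cs.
by rewrite inE xs orbT.
Qed.

Fixpoint hdepth (r : htree P T) : nat :=
  let: HTree s _ := r in
  (foldr (fun x m => let: (r', _, _) := x in maxn (hdepth r') m) 0 s).+1.

Lemma thist_ind (Q : thist -> Prop) :
  (forall S t, (forall v, v \in S -> Q (ph_src v)) -> Q (mkthist S t)) ->
  forall h, Q h.
Proof.
move=> IH h; have [n] := ubnP (hdepth (htree_of h)).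
elim: n h => // n IHn h; rewrite -{2}[h]mkthistE ltnS => hn.
apply: IH => v; rewrite -(perm_mem (perm_eq_seq_mset _)) => vh; apply: IHn.
apply: leq_trans hn; move: vh; rewrite seq_mset_id /thist_mset.
case: (htree_of h) => s t.
rewrite (perm_mem (perm_eq_seq_mset _)) mem_pmap => /mapP[[[r p] c] xs].
rewrite /raise /=; case: insubP => //= h' _ hr [->]; rewrite /ph_src /= hr ltnS.
elim: s xs {hr} => //= -[[r' p'] c'] s IHs; rewrite inE => /orP[/eqP[-> _ _]|/IHs] /=.
  exact: leq_maxl.
by move=> /leq_trans; apply; exact: leq_maxr.
Qed.

(** (∅, t_ε) *)
Definition eps_hist : thist := mkthist mset0 None.

(** h(v): the multiplicity of v in the multiset of h. *)
Definition mult (h : thist) (v : phist) : nat := thist_mset h v.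

Variable N : ptiNet P T.

Definition post (t : option T) (p : P) : nat :=
  if t is Some t' then flow_out N t' p else m0 N p.

Inductive hist_t : thist -> Prop :=
| hist_t_eps : hist_t eps_hist
| hist_t_run (S : {mset phist}) (t : T) :
    (forall v, v \in S -> hist_p v) ->
    (forall v, v \in S -> S v <= ph_count v) ->
    (forall p, flow_in N p t = \sum_(v <- finsupp S) S v * (ph_place v == p)) ->
    hist_t (mkthist S (Some t))
with hist_p : phist -> Prop :=
| hist_p_place (h : thist) (p : P) :
    hist_t h -> 0 < post (thist_lab h) p ->
    hist_p (h, p, post (thist_lab h) p).

(** g-computations. *)

Definition hLPO := gLPO phist thist P (option T).

Implicit Type G : hLPO.

Definition consumers G (v : phist) : set thist := [set e | arc G (inl v) (inr e)].

Definition taken G (v : phist) : nat := \big[addn/0]_(e \in consumers G v) mult e v.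

(** For g-computations [taken G v <= ph_count v], so subtraction does not truncate. *)
Definition tokens_not_taken G (v : phist) : nat := ph_count v - taken G v.

Definition histories_labelled G : Prop :=
  [/\ nodes G `<=` hist_p, edges G `<=` hist_t,
      forall v : nodes G, nlab v = ph_place (\val v)
    & forall e : edges G, elab e = thist_lab (\val e)].

Definition N1 G : Prop :=
  is_minimal G (inr eps_hist) /\ forall a, is_minimal G a -> a = inr eps_hist.

Definition N2 G : Prop :=
  forall v, nodes G v ->
    edges G (ph_src v) /\ forall e, arc G (inr e) (inl v) <-> e = ph_src v.

(** [taken] is a finitely supported sum, equal to 0 on an infinite set of
    consumers; finiteness is implicit in the bound on a sum of positive numbers. *)
Definition N3 G : Prop :=
  forall v, nodes G v ->
    [/\ forall e, consumers G v e -> 0 < mult e v,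
        finite_set (consumers G v)
      & taken G v <= ph_count v].

Definition N4 G : Prop :=
  forall e, edges G e ->
    preset G (inr e) = [set inl v | v in [set v | v \in thist_mset e]] /\
    postset G (inr e) =
      [set inl (e, p, post (thist_lab e) p) | p in [set p | 0 < post (thist_lab e) p]].

Definition N5 G : Prop :=
  forall t : T, glue_of G (Some t) =
    [set a | exists (v : nodes G) (e : edges G),
       [/\ a = (inl (\val v), inr (\val e)), arc G (inl (\val v)) (inr (\val e))
         & inhibitor N (nlab v, t)]]
    `|`
    [set a | exists (v : nodes G) (e : edges G),
       [/\ a = (inr (\val e), inl (\val v)), arc G (inr (\val e)) (inl (\val v))
         & inhibitor N (nlab v, t)]].

Definition comp_g G : Prop :=
  [/\ is_gLPO G, histories_labelled G, glues G = range (glue_of G)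
    & glue_of G None = set0] /\
  [/\ N1 G, N2 G, N3 G, N4 G & N5 G].

End Histories.

(* Main.v *)
(** A g-computation is determined by its set of edges: N2 and N4 recover the
    nodes and the arcs from it, and N5 then recovers the glue. So two different
    g-computations differ in some edge. Take such an edge (S, t) of least depth;
    the sources of the p-histories in S are then edges of both g-computations,
    so by N4 those p-histories are nodes of both, and alternative 2 holds. *)
Require Import Defs.
From mathcomp Require Import all_boot.
From mathcomp Require Import finmap multiset.
From mathcomp Require Import boolp classical_sets functions cardinality fsbigop.
Import Defs.

Set Implicit Arguments.
Unset Strict Implicit.
Unset Printing Implicit Defensive.

Local Open Scope classical_set_scope.

Section Computations.
Variables (P : finType) (T : Type) (N : ptiNet P T).
Implicit Types (G : hLPO P T) (v : phist P T) (e : thist P T).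

Lemma arc_node_edge G v e :
  comp_g N G -> arc G (inl v) (inr e) -> nodes G v /\ edges G e.
Proof.
move=> [[[[sub _ _ _] _ _] _ _ _] _] /sub[] [[/= x Hx Ex] [y Hy Ey]] //.
by case: Ex Ey => <- [<-].
Qed.

Lemma arc_edge_node G v e :
  comp_g N G -> arc G (inr e) (inl v) -> nodes G v /\ edges G e.
Proof.
move=> [[[[sub _ _ _] _ _] _ _ _] _] /sub[] [[/= x Hx Ex] [y Hy Ey]] //.
by case: Ex Ey => <- [<-].
Qed.

Lemma arc_objects G a b : comp_g N G -> arc G a b ->
  (exists v e, a = inl v /\ b = inr e) \/ (exists v e, a = inr e /\ b = inl v).
Proof.
move=> [[[[sub _ _ _] _ _] _ _ _] _] /sub[] [[/= x _ <-] [y _ <-]].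
- by left; exists x, y.
- by right; exists y, x.
Qed.

(** N4 equates the preset of an edge with the support of its multiset, so the set of edges alone
    determines the arcs from nodes to edges. *)
Lemma arc_consumer G v e : comp_g N G ->
  arc G (inl v) (inr e) <-> edges G e /\ v \in thist_mset e.
Proof.
move=> cG; have [_ [_ _ _ n4 _]] := cG.
split=> [ve | [/n4[pre _] ve]].
  have [_ Ge] := arc_node_edge cG ve; have [pre _] := n4 _ Ge.
  have : preset G (inr e) (inl v) by [].
  by rewrite pre => -[w we [<-]].
suff: preset G (inr e) (inl v) by [].
by rewrite pre; exists v.
Qed.

Lemma arc_producer G v e : comp_g N G ->
  arc G (inr e) (inl v) <-> nodes G v /\ e = ph_src v.
Proof.
move=> cG; have [_ [_ n2 _ _ _]] := cG.
split=> [ev | [Gv ->]]; last by apply/(n2 _ Gv).2.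
have [Gv _] := arc_edge_node cG ev.
by split=> //; apply/(n2 _ Gv).2.
Qed.

(** The source is an edge by N2. Conversely, [hist_p] forces the count of [v] to be
    [post N (thist_lab h) p], so N4 puts [v] in the postset of its source [h], and endpoints of arcs
    are objects of [G]. *)
Lemma node_src G v : comp_g N G ->
  nodes G v <-> hist_p N v /\ edges G (ph_src v).
Proof.
move=> cG; have [[_ [np _ _ _] _ _] [_ n2 _ n4 _]] := cG.
split=> [Gv | [hv]]; first by split; [exact: np | case: (n2 _ Gv)].
case: hv => h p _ p_gt0 /n4[_ post_h].
suff /(arc_edge_node cG)[] :
    arc G (inr h) (inl (h, p, post N (thist_lab h) p)) by [].
suff: postset G (inr h) (inl (h, p, post N (thist_lab h) p)) by [].
by rewrite post_h; exists p.
Qed.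

Lemma edges_eps G : comp_g N G -> edges G (eps_hist P T).
Proof. by move=> [_ [[[[[x _] //|[x Gx [<-]]] _] _] _ _ _ _]]. Qed.

Lemma comp_g_eq_edges G G' :
  comp_g N G -> comp_g N G' -> edges G = edges G' -> G = G'.
Proof.
move=> cG cG' eqE.
have eqV : nodes G = nodes G'.
  apply/seteqP; split=> v Gv.
    by apply/(node_src v cG'); rewrite -eqE; apply/node_src.
  by apply/(node_src v cG); rewrite eqE; apply/node_src.
have eqA : arcs G = arcs G'.
  apply/seteqP; split=> -[a b] ab.
    have [[v [e [? ?]]]|[v [e [? ?]]]] := arc_objects cG ab; subst a b.
      by apply/(arc_consumer _ _ cG'); rewrite -eqE; apply/arc_consumer.
    by apply/(arc_producer _ _ cG'); rewrite -eqV; apply/arc_producer.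
  have [[v [e [? ?]]]|[v [e [? ?]]]] := arc_objects cG' ab; subst a b.
    by apply/(arc_consumer _ _ cG); rewrite eqE; apply/arc_consumer.
  by apply/(arc_producer _ _ cG); rewrite eqV; apply/arc_producer.
case: cG cG' => [[_ [_ _ + +] + +] [_ _ _ _ +]].
move=> + + + + + [[_ [_ _ + +] + +] [_ _ _ _ +]].
case: G G' eqE eqV eqA => [V E A l k g gl] [V' E' A' l' k' g' gl'] /=.
(* The labellings are functions on the node and edge sets, so they can be compared only once these
   sets are identified. *)
move=> ? ? ?; subst V' E' A'; rewrite /N5 /arc /=.
move=> lE kE gE gl0 glE l'E k'E g'E gl'0 gl'E.
have ? : l = l' by apply: funext => v; rewrite lE l'E.
have ? : k = k' by apply: funext => e; rewrite kE k'E.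
subst l' k'.
have ? : gl = gl' by apply: funext => -[t|]; rewrite ?gl0 ?gl'0 // glE gl'E.
by subst gl' g g'.
Qed.

Lemma edge_not_shared G G' : comp_g N G -> comp_g N G' ->
  ~ edges G `<=` edges G' ->
  exists (S : {mset (phist P T)}%mset) (t : T),
    [/\ hist_t N (mkthist S (Some t)),
        forall v, v \in S -> nodes G v /\ nodes G' v,
        edges G (mkthist S (Some t)) & ~ edges G' (mkthist S (Some t))].
Proof.
move=> cG cG' nsub; apply: contrapT => none; apply: nsub.
(* Least depth becomes structural induction: if no edge witnesses the claim, every edge of [G] is an
   edge of [G']. *)
elim/thist_ind=> S t IH GS; apply: contrapT => nG'S; apply: none.
have hS : hist_t N (mkthist S t) by have [[_ [_ + _ _] _ _] _] := cG; apply.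
(* Only the dummy history has label [None], and N1 makes it an edge of every g-computation. *)
case: t => [t|] in IH GS nG'S hS *; last first.
  exfalso; apply: nG'S; move Eh: (mkthist S None) hS => h hS.
  case: hS Eh => [_|S' t' _ _ _ /(congr1 (@thist_lab P T)) //].
  exact: edges_eps cG'.
exists S, t; split=> // v vS.
have [Gv _] : nodes G v /\ edges G (mkthist S (Some t)).
  by apply: (arc_node_edge cG); apply/(arc_consumer _ _ cG); rewrite mkthistK_mset.
(* The source of [v] is an edge of [G], hence of [G'] by induction, which makes [v] a node of
   [G']. *)
split=> //; have [hv Gsrc] := (node_src v cG).1 Gv.
by apply/(node_src v cG'); split=> //; apply: IH.
Qed.

End Computations.

Theorem theorem3 (P : finType) (T : Type) (N : ptiNet P T) (G1 G2 : hLPO P T)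
  (hG1 : comp_g N G1) (hG2 : comp_g N G2) (neqG : G1 <> G2) :
  exists A : {fset (phist P T)},
    (forall v, v \in A -> nodes G1 v /\ nodes G2 v) /\
    ((exists v, v \in A /\ tokens_not_taken G1 v <> tokens_not_taken G2 v) \/
     (exists (S : {mset (phist P T)}%mset) (t : T),
        [/\ hist_t N (mkthist S (Some t)),
            finsupp S = A
          & (edges G1 (mkthist S (Some t)) /\ ~ edges G2 (mkthist S (Some t))) \/
            (edges G2 (mkthist S (Some t)) /\ ~ edges G1 (mkthist S (Some t)))])).
Proof.
have [sub12|/edge_not_shared] := pselect (edges G1 `<=` edges G2); last first.
  move=> /(_ _ hG1 hG2)[S [t [hS nS S1 S2]]].
  (* The required set is the support of the multiset of the unshared edge. *)
  exists (finsupp S); split; first by move=> v; rewrite msuppE => /nS.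
  by right; exists S, t; split=> //; left.
have [sub21|/edge_not_shared] := pselect (edges G2 `<=` edges G1); last first.
  move=> /(_ _ hG2 hG1)[S [t [hS nS S2 S1]]].
  exists (finsupp S); split; first by move=> v; rewrite msuppE => /nS[].
  by right; exists S, t; split=> //; right.
by case: neqG; apply: (comp_g_eq_edges hG1 hG2); apply/seteqP.
Qed.
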